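(* There exists a function $\Xi:\mathbb{X}\times\mathbb{U}\to\mathbb{R}$ such that the function $f:\mathbb{X}\times\mathbb{U}\to\mathbb{R}^5$ defined, for $x=(x^{(1)},\dots,x^{(5)})\in\mathbb{X}$ and $u\in\mathbb{U}$, by $$f(x,u)=\begin{pmatrix} x^{(1)}-\Phi^{(1)}(x,u)\\ x^{(2)}-\Phi^{(2)}(x,u)+\Big[x^{(1)}R_s(x^{(5)})-\big(x^{(1)}-\Phi^{(1)}(x,u)\big)R_s\big(\Xi(x,u)\big)\Big]\\ x^{(3)}-\Phi^{(3)}(x,u)\\ x^{(4)}\Big(1+c_f\big(\Xi(x,u)-x^{(5)}\big)\Big)\\ \Xi(x,u)\end{pmatrix}$$ is the dynamics of the reservoir. That is, for every sequence of states $(x_t)_{t=0,\dots,T}$ in $\mathbb{X}$ and of controls $(u_t)_{t=0,\dots,T-1}$ in $\mathbb{U}$ satisfying the reservoir equations (R1)–(R6) listed in the context, one has $x_{t+1}=f(x_t,u_t)$ for all $t\in\{0,\dots,T-1\}$.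
   Context: Time steps are $t\in\{0,1,\dots,T\}$ with $T\in\mathbb{N}$. The state space is $\mathbb{X}\subset\mathbb{R}^5$ and the control space is $\mathbb{U}\subset\mathbb{R}^p$. A state is $x_t=(V^o_t,V^g_t,V^w_t,V^p_t,P_t)$, where $V^o_t,V^g_t,V^w_t$ are the standard volumes of oil, free gas and water in the reservoir, $V^p_t>0$ is the total pore volume and $P_t$ is the reservoir pressure. The production mapping $\Phi=(\Phi^{(1)},\Phi^{(2)},\Phi^{(3)}):\mathbb{X}\times\mathbb{U}\to\mathbb{R}^3$ is given; it returns the volumes of oil, free gas and water produced during $[t,t+1[$. Also given are functions of pressure $B_o,B_g,B_w$ (formation volume factors of oil, gas and water) and $R_s$ (solution gas function), and a constant $c_f>0$ (pore compressibility). Under the black-oil and tank-like assumptions, the reservoir equations are: (R1) $(F^o_t,F^g_t,F^w_t)=\Phi(x_t,u_t)$ for $t\in\{0,\dots,T-1\}$; (R2) $V^o_{t+1}=V^o_t-F^o_t$ for $t\in\{0,\dots,T-1\}$; (R3) $V^w_{t+1}=V^w_t-F^w_t$ for $t\in\{0,\dots,T-1\}$; (R4) $V^g_{t+1}=V^g_t-F^g_t+\big(V^o_tR_s(P_t)-V^o_{t+1}R_s(P_{t+1})\big)$ for $t\in\{0,\dots,T-1\}$ (the dissolved gas at time $t$ is $V^o_tR_s(P_t)$); (R5) $V^p_{t+1}-V^p_t=c_f\,V^p_t\,(P_{t+1}-P_t)$ for $t\in\{0,\dots,T-1\}$; (R6) $V^o_tB_o(P_t)+V^g_tB_g(P_t)+V^w_tB_w(P_t)=V^p_t$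 for $t\in\{0,\dots,T\}$. Standing assumption of the black-oil model (the total volume occupied by the fluids decreases with pressure): for every $(x,u)\in\mathbb{X}\times\mathbb{U}$, the function $$P\mapsto \big(x^{(1)}-\Phi^{(1)}(x,u)\big)B_o(P)+\big(x^{(3)}-\Phi^{(3)}(x,u)\big)B_w(P)+\Big[x^{(2)}-\Phi^{(2)}(x,u)+x^{(1)}R_s(x^{(5)})-\big(x^{(1)}-\Phi^{(1)}(x,u)\big)R_s(P)\Big]B_g(P)$$ is decreasing in the pressure $P$. *)

(* Defs.v *)
From mathcomp Require Import all_boot all_order all_algebra.
From mathcomp Require Import all_classical all_reals all_analysis.

Set Implicit Arguments.
Unset Strict Implicit.
Unset Printing Implicit Defensive.

Import Order.TTheory GRing.Theory Num.Theory.
Local Open Scope ring_scope.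

(* A state is the row vector (V^o, V^g, V^w, V^p, P); coordinates are
   numbered from 0, so x^(k) in the usual 1-based notation has index k.-1. *)
Definition Vo (R : realType) (x : 'rV[R]_5) : R := x ord0 (inord 0).
Definition Vg (R : realType) (x : 'rV[R]_5) : R := x ord0 (inord 1).
Definition Vw (R : realType) (x : 'rV[R]_5) : R := x ord0 (inord 2).
Definition Vp (R : realType) (x : 'rV[R]_5) : R := x ord0 (inord 3).
Definition Pres (R : realType) (x : 'rV[R]_5) : R := x ord0 (inord 4).

(* A production is the row vector (F^o, F^g, F^w). *)
Definition Fo (R : realType) (q : 'rV[R]_3) : R := q ord0 (inord 0).
Definition Fg (R : realType) (q : 'rV[R]_3) : R := q ord0 (inord 1).
Definition Fw (R : realType) (q : 'rV[R]_3) : R := q ord0 (inord 2).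

(* Only x_0, ..., x_T and u_0, ..., u_(T-1), F_0, ..., F_(T-1) are
   constrained; later terms of the sequences are irrelevant. *)
Record reservoir_equations (R : realType) (p T : nat)
    (Phi : 'rV[R]_5 -> 'rV[R]_p -> 'rV[R]_3)
    (Bo Bg Bw Rs : R -> R) (cf : R)
    (x : nat -> 'rV[R]_5) (u : nat -> 'rV[R]_p) (F : nat -> 'rV[R]_3) : Prop :=
  ReservoirEquations {
    production_eq : forall t, (t < T)%N -> F t = Phi (x t) (u t);
    oil_balance : forall t, (t < T)%N ->
      Vo (x t.+1) = Vo (x t) - Fo (F t);
    water_balance : forall t, (t < T)%N ->
      Vw (x t.+1) = Vw (x t) - Fw (F t);
    gas_balance : forall t, (t < T)%N ->
      Vg (x t.+1) = Vg (x t) - Fg (F t)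
        + (Vo (x t) * Rs (Pres (x t)) - Vo (x t.+1) * Rs (Pres (x t.+1)));
    pore_compressibility : forall t, (t < T)%N ->
      Vp (x t.+1) - Vp (x t) = cf * Vp (x t) * (Pres (x t.+1) - Pres (x t));
    volume_conservation : forall t, (t <= T)%N ->
      Vo (x t) * Bo (Pres (x t)) + Vg (x t) * Bg (Pres (x t))
        + Vw (x t) * Bw (Pres (x t)) = Vp (x t)
  }.

(* Volume, at pressure P, of the fluids left after producing from x under u. *)
Definition fluid_volume (R : realType) (p : nat)
    (Phi : 'rV[R]_5 -> 'rV[R]_p -> 'rV[R]_3) (Bo Bg Bw Rs : R -> R)
    (x : 'rV[R]_5) (u : 'rV[R]_p) (P : R) : R :=
  (Vo x - Fo (Phi x u)) * Bo P
  + (Vw x - Fw (Phi x u)) * Bw P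
  + (Vg x - Fg (Phi x u) + Vo x * Rs (Pres x) - (Vo x - Fo (Phi x u)) * Rs P)
    * Bg P.

Definition reservoir_dynamics (R : realType) (p : nat)
    (Phi : 'rV[R]_5 -> 'rV[R]_p -> 'rV[R]_3) (Rs : R -> R) (cf : R)
    (Xi : 'rV[R]_5 -> 'rV[R]_p -> R)
    (x : 'rV[R]_5) (u : 'rV[R]_p) : 'rV[R]_5 :=
  \row_(j < 5) nth 0
    [:: Vo x - Fo (Phi x u);
        Vg x - Fg (Phi x u)
          + (Vo x * Rs (Pres x) - (Vo x - Fo (Phi x u)) * Rs (Xi x u));
        Vw x - Fw (Phi x u);
        Vp x * (1 + cf * (Xi x u - Pres x));
        Xi x u] j.

(* Main.v *)
Require Import Defs.
From mathcomp Require Import all_boot all_order all_algebra.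
From mathcomp Require Import all_classical all_reals all_analysis.
From mathcomp Require Import ring.

Set Implicit Arguments.
Unset Strict Implicit.
Unset Printing Implicit Defensive.

Import Order.TTheory GRing.Theory Num.Theory.
Local Open Scope classical_set_scope.
Local Open Scope ring_scope.

(** Substituting the oil, gas and water balances into volume conservation at
    time t+1 eliminates every unknown of the next state except its pressure P,
    and the pore equation gives the pore volume as an affine function of P.
    The next pressure therefore solves the scalar equation
      fluid_volume x u P = Vp x * (1 + cf * (P - Pres x)),
    whose data are the current state and control alone.  Its left side is
    nonincreasing in P, and its right side is strictly increasing because
    cf * Vp x > 0, so it has at most one solution ([crossing_unique]).  Letting
    Xi x u be a solution whenever there is one, Xi must return the actual next
    pressure along every trajectory ([next_pressure_balance]); the remaining
    coordinates of the dynamics are the balances themselves.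

    Existence of a root is never at stake: a trajectory supplies one, and where
    the equation has none the value of Xi is irrelevant. *)

(** If a < b then g a < g b = f b <= f a = g a, a contradiction; so strictness
    of g alone compensates for f being possibly constant between a and b. *)
Lemma crossing_unique d d' (S : orderType d) (S' : porderType d')
    (f g : S -> S') (a b : S) :
  {homo f : x y / (x <= y)%O >-> (y <= x)%O} ->
  {homo g : x y / (x < y)%O} ->
  f a = g a -> f b = g b -> a = b.
Proof.
move=> f_dec g_inc fga fgb; case: (ltgtP a b) => // [ltab | ltba].
- have := g_inc _ _ ltab; rewrite -fga -fgb.
  by move=> /lt_le_trans/(_ (f_dec _ _ (ltW ltab))); rewrite ltxx.
- have := g_inc _ _ ltba; rewrite -fga -fgb.
  by move=> /lt_le_trans/(_ (f_dec _ _ (ltW ltba))); rewrite ltxx.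
Qed.

Definition pore_volume (R : realType) (cf : R) (x : 'rV[R]_5) (P : R) : R :=
  Vp x * (1 + cf * (P - Pres x)).

Lemma pore_volume_increasing (R : realType) (cf : R) (x : 'rV[R]_5) :
  0 < cf -> 0 < Vp x -> {homo pore_volume cf x : P Q / P < Q}.
Proof.
by move=> cf0 Vp0 P Q ltPQ; rewrite ltr_pM2l// ltrD2l ltr_pM2l// ltrD2r.
Qed.

Lemma next_pore_volume (R : realType) (p T : nat)
    (Phi : 'rV[R]_5 -> 'rV[R]_p -> 'rV[R]_3) (Bo Bg Bw Rs : R -> R) (cf : R)
    (x : nat -> 'rV[R]_5) (u : nat -> 'rV[R]_p) (F : nat -> 'rV[R]_3) t :
  reservoir_equations T Phi Bo Bg Bw Rs cf x u F -> (t < T)%N ->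
  Vp (x t.+1) = pore_volume cf (x t) (Pres (x t.+1)).
Proof.
move=> eqs ltT; have := pore_compressibility eqs ltT.
by move=> /eqP; rewrite subr_eq => /eqP ->; rewrite /pore_volume; ring.
Qed.

(** The next pressure is a root of an equation whose data are known at time t.
    Volume conservation has to be taken at time t+1, since at time t it does
    not involve the next pressure. *)
Lemma next_pressure_balance (R : realType) (p T : nat)
    (Phi : 'rV[R]_5 -> 'rV[R]_p -> 'rV[R]_3) (Bo Bg Bw Rs : R -> R) (cf : R)
    (x : nat -> 'rV[R]_5) (u : nat -> 'rV[R]_p) (F : nat -> 'rV[R]_3) t :
  reservoir_equations T Phi Bo Bg Bw Rs cf x u F -> (t < T)%N ->
  fluid_volume Phi Bo Bg Bw Rs (x t) (u t) (Pres (x t.+1)) =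
  pore_volume cf (x t) (Pres (x t.+1)).
Proof.
move=> eqs ltT; rewrite -(next_pore_volume eqs ltT).
rewrite -(volume_conservation eqs ltT) (gas_balance eqs ltT).
rewrite (oil_balance eqs ltT) (water_balance eqs ltT) (production_eq eqs ltT).
by rewrite /fluid_volume; ring.
Qed.

Theorem proposition2 (R : realType) (p T : nat)
    (X : set 'rV[R]_5) (U : set 'rV[R]_p)
    (Phi : 'rV[R]_5 -> 'rV[R]_p -> 'rV[R]_3)
    (Bo Bg Bw Rs : R -> R) (cf : R)
    (cf_gt0 : 0 < cf)
    (Vp_gt0 : forall x, X x -> 0 < Vp x)
    (fluid_volume_decreasing : forall x u, X x -> U u ->
      nonincreasing_fun (fluid_volume Phi Bo Bg Bw Rs x u)) :
  exists Xi : 'rV[R]_5 -> 'rV[R]_p -> R,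
    forall (x : nat -> 'rV[R]_5) (u : nat -> 'rV[R]_p) (F : nat -> 'rV[R]_3),
      (forall t, (t <= T)%N -> X (x t)) ->
      (forall t, (t < T)%N -> U (u t)) ->
      reservoir_equations T Phi Bo Bg Bw Rs cf x u F ->
      forall t, (t < T)%N ->
        x t.+1 = reservoir_dynamics Phi Rs cf Xi (x t) (u t).
Proof.
pose balance x u := [set P | fluid_volume Phi Bo Bg Bw Rs x u P =
                             pore_volume cf x P].
exists (fun x u => xget 0 (balance x u)) => x u F Xx Uu eqs t ltT.
have XiE : xget 0 (balance (x t) (u t)) = Pres (x t.+1).
  have Xxt : X (x t) by apply/Xx/ltnW.
  have root_next := next_pressure_balance eqs ltT.
  apply: (crossing_unique (fluid_volume_decreasing _ _ Xxt (Uu _ ltT))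
    (pore_volume_increasing cf_gt0 (Vp_gt0 _ Xxt)) _ root_next).
  exact: (xgetI 0 (root_next : balance (x t) (u t) _)).
apply/rowP => j; rewrite mxE XiE -(production_eq eqs ltT).
rewrite -(oil_balance eqs ltT) -(water_balance eqs ltT).
rewrite -(gas_balance eqs ltT).
rewrite -/(pore_volume cf (x t) (Pres (x t.+1))) -(next_pore_volume eqs ltT).
(* The coordinates of x t.+1 are read through inord, so j is put in that form
   before it is split into its five values. *)
by rewrite -[j in LHS]inord_val; case: j => -[|[|[|[|[|[]]]]]].
Qed.
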